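(* Let one pursuer $P$ and one evader $E$ evolve under the discrete linear relative-motion dynamics $\bm{x}^{(j)}_{k}=A_d\bm{x}^{(j)}_{k-1}+B_d\bm{u}^{(j)}_{k-1}$, $k=1,\dots,N$, from given initial states, with box-bounded controls $\|\bm{u}^{(j)}_k\|_\infty\le \bar u_j$, as specified in the context. Let $\hat{\mathcal{R}}_N^{(E)}$ be the outer polytope of the evader's terminal-position reachable set built from $L\ge 3$ template directions uniformly distributed on the unit circle (see context), let $\{\bm{v}_j\}$ be its finite set of vertices, and let $$\bar V=\min_{\bm{U}^{(P)}\ \text{admissible}}\ \max_{j}\ \bigl\|\bm{r}_N^{(P)}(\bm{U}^{(P)})-\bm{v}_j\bigr\|_2 ,$$ attained by a control sequence $\bm{U}^{(P)}_{\mathrm{sec}}$ (the pursuer security control), where $\bm{r}_N^{(P)}(\bm{U}^{(P)})$ is the pursuer's terminal position under $\bm{U}^{(P)}$. Then, if the pursuer plays $\bm{U}^{(P)}_{\mathrm{sec}}$, for every admissible control sequence of the evader the terminal positions satisfy $$\bigl\|\bm{r}_N^{(P)}-\bm{r}_N^{(E)}\bigr\|_2\le\bar V .$$ In particular, if $\bar V\le r_{\mathrm{cap}}$ for a capture radius $r_{\mathrm{cap}}>0$, then playing $\bm{U}^{(P)}_{\mathrm{sec}}$ guarantees capture, i.e. $\|\bm{r}_N^{(P)}-\bm{r}_N^{(E)}\|_2\le r_{\mathrm{cap}}$, against every admissible evader control sequence.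
   Context: Dynamics (planar Hill--Clohessy--Wiltshire model). The state is $\bm{x}=[x,y,\dot x,\dot y]^\top\in\mathbb{R}^4$, the control is an acceleration $\bm{u}=[u_x,u_y]^\top\in\mathbb{R}^2$, and the position is $\bm{r}=[x,y]^\top\in\mathbb{R}^2$. The continuous-time system $\dot{\bm{x}}=A_c\bm{x}+B_c\bm{u}$ is $\ddot x-2n\dot y-3n^2x=u_x$, $\ddot y+2n\dot x=u_y$, with $n>0$. For a timestep $\Delta t>0$, $A_d\in\mathbb{R}^{4\times4}$ and $B_d\in\mathbb{R}^{4\times2}$ are given by $\exp\!\left(\begin{bmatrix}A_c&B_c\\0&0\end{bmatrix}\Delta t\right)=\begin{bmatrix}A_d&B_d\\0&I\end{bmatrix}$. Each agent $j\in\{P,E\}$ evolves by $\bm{x}^{(j)}_{k}=A_d\bm{x}^{(j)}_{k-1}+B_d\bm{u}^{(j)}_{k-1}$, $k=1,\dots,N$ ($N\ge1$), from a given $\bm{x}_0^{(j)}$; $\bm{r}_N^{(j)}$ is the position part of $\bm{x}_N^{(j)}$. A control sequence $\bm{U}^{(j)}=(\bm{u}^{(j)}_0,\dots,\bm{u}^{(j)}_{N-1})$ is admissible if $\|\bm{u}^{(j)}_k\|_\infty\le\bar u_j$ for all $k$, with $\bar u_P>\bar u_E>0$. Outer polytope. Let $\mathcal{R}_N^{(E)}\subset\mathbb{R}^2$ be the set of evader terminal positions reachable with admissible controls, with support function $h_E(\bm{d})=\max_{\bm{r}\in\mathcal{R}_N^{(E)}}\bm{d}^\top\bm{r}$. For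 $L$ unit vectors $\bm{d}_1,\dots,\bm{d}_L\in\mathbb{R}^2$ uniformly distributed (equally spaced) on the unit circle, $$\hat{\mathcal{R}}_N^{(E)}=\bigcap_{\ell=1}^{L}\{\bm{r}\in\mathbb{R}^2:\bm{d}_\ell^\top\bm{r}\le h_E(\bm{d}_\ell)\}\supseteq\mathcal{R}_N^{(E)} .$$ *)

(* Defs.v *)
From HB Require Import structures.
From mathcomp Require Import all_boot all_order all_algebra.
From mathcomp Require Import all_classical all_reals all_analysis.
From mathcomp Require Import ring.

Set Implicit Arguments.
Unset Strict Implicit.
Unset Printing Implicit Defensive.

Import Order.TTheory GRing.Theory Num.Theory.
Import numFieldNormedType.Exports.

Local Open Scope classical_set_scope.
Local Open Scope ring_scope.

Section Euclidean.
Variables (R : realType) (m : nat).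

(* The library norm [`|v|] on ['cV[R]_m] is the sup norm. *)
Definition norm2 (v : 'cV[R]_m) : R := Num.sqrt (\sum_i v i 0 ^+ 2).

Definition dot (d r : 'cV[R]_m) : R := \sum_i d i 0 * r i 0.

(* The sup is a maximum when [S] is nonempty and compact. *)
Definition support (S : set 'cV[R]_m) (d : 'cV[R]_m) : R :=
  sup [set dot d r | r in S].

(* The vertices of a convex polytope, defined as its extreme points. *)
Definition vertices (P : set 'cV[R]_m) : set 'cV[R]_m :=
  [set v | P v /\
    forall (a b : 'cV[R]_m) (t : R), P a -> P b -> 0 < t < 1 ->
      v = t *: a + (1 - t) *: b -> a = v /\ b = v].

(* The sup is a maximum when [V] is nonempty and finite. *)
Definition max_dist (V : set 'cV[R]_m) (r : 'cV[R]_m) : R :=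
  sup [set norm2 (r - v) | v in V].

End Euclidean.

Section MatrixExponential.
Variables (R : realType) (m : nat).

Definition expmx_coeff (A : 'M[R]_m) (k : nat) : 'M[R]_m :=
  k`!%:R^-1 *: A ^+ k.

Definition expmx (A : 'M[R]_m) : 'M[R]_m := limn (series (expmx_coeff A)).

Lemma normr_mulmx (A B : 'M[R]_m) : `|A * B| <= m%:R * `|A| * `|B|.
Proof.
have nE (C : 'M[R]_m) : `|C| = \big[Num.max/0]_ij `|C ij.1 ij.2| := mx_normrE C.
have le_n (C : 'M[R]_m) i j : `|C i j| <= `|C|.
  by rewrite nE; apply/bigmax_geP; right; exists (i, j).
rewrite [leLHS]nE; apply/bigmax_leP; split=> [|[i j] _ /=].
  by rewrite !mulr_ge0.
rewrite mxE; apply: le_trans (ler_norm_sum _ _ _) _.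
rewrite -mulrA mulr_natl -[X in _ *+ X](card_ord m) -sumr_const.
by apply: ler_sum => k _; rewrite normrM ler_pM.
Qed.

Lemma is_cvg_series_expmx_coeff (A : 'M[R]_m) : cvgn (series (expmx_coeff A)).
Proof.
pose c : R := m%:R * `|A|.
have c0 : 0 <= c by rewrite mulr_ge0.
have : cvgn [normed series (expmx_coeff A)].
  apply: (@series_le_cvg _ _ (`|1 : 'M[R]_m| *: exp_coeff c)).
  - by move=> k; exact: normr_ge0.
  - by move=> k; rewrite mulr_ge0 // exp_coeff_ge0.
  - move=> k; rewrite /= /expmx_coeff normrZ ger0_norm ?invr_ge0//.
    rewrite [leRHS]mulrA mulrC ler_wpM2r ?invr_ge0//.
    elim: k => [|k IH]; first by rewrite !expr0 mulr1.
    by rewrite !exprS (le_trans (normr_mulmx _ _))// mulrCA ler_wpM2l.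
  - by apply: is_cvg_seriesZ; exact: is_cvg_series_exp_coeff.
move=> /cauchy_cvgP/cauchy_seriesP u_ncvg.
apply/cauchy_cvgP/cauchy_seriesP => e /u_ncvg.
apply: filterS => k /=; rewrite ger0_norm ?sumr_ge0//.
by apply: le_lt_trans; apply: ler_norm_sum.
Qed.

End MatrixExponential.

Section Dynamics.
Variables (R : realType) (n dt : R).

(* State [x; y; x'; y'], split as position (first two coordinates) and velocity
   (last two); [hcw_fieldE] below spells out the differential system. *)
Definition hcw_A : 'M[R]_(2 + 2) := \matrix_(i, j)
  nth 0 (nth [::] [:: [:: 0;          0; 1;          0      ];
                      [:: 0;          0; 0;          1      ];
                      [:: 3 * n ^+ 2; 0; 0;          2 * n  ];
                      [:: 0;          0; - (2 * n);  0      ]] i) j.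

Definition hcw_B : 'M[R]_(2 + 2, 2) := col_mx 0 1%:M.

Lemma hcw_fieldE (x : 'cV[R]_(2 + 2)) (u : 'cV[R]_2) :
  let X (i : nat) := x (inord i) 0 in
  let xdot := hcw_A *m x + hcw_B *m u in
  [/\ xdot (inord 0) 0 = X 2%N, xdot (inord 1) 0 = X 3%N,
      xdot (inord 2) 0 - 2 * n * X 3%N - 3 * n ^+ 2 * X 0%N = u 0 0 &
      xdot (inord 3) 0 + 2 * n * X 2%N = u 1 0].
Proof.
have lE i : (lshift 2 i : 'I_(2 + 2)) = inord i.
  by apply/val_inj; rewrite /= inordK // (leq_trans (ltn_ord i)).
have rE i : (rshift 2 i : 'I_(2 + 2)) = inord (2 + i).
  by apply/val_inj; rewrite /= inordK // ltn_add2l.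
have BE (k : nat) (kb : (k < 4)%N) : (hcw_B *m u) (inord k) 0
    = if (k < 2)%N then 0 else u (inord (k - 2)) 0.
  rewrite /hcw_B mul_col_mx mul0mx mul1mx.
  case: ltnP => k2.
    rewrite -(_ : lshift 2 (inord k : 'I_2) = inord k); last first.
      by rewrite lE inordK.
    by rewrite col_mxEu mxE.
  rewrite -(_ : rshift 2 (inord (k - 2) : 'I_2) = inord k); last first.
    by rewrite rE inordK ?subnKC// ltn_subLR.
  by rewrite col_mxEd.
have AE (k : nat) : (hcw_A *m x) (inord k) 0 =
    hcw_A (inord k) (inord 0) * x (inord 0) 0
    + (hcw_A (inord k) (inord 1) * x (inord 1) 0
    + (hcw_A (inord k) (inord 2) * x (inord 2) 0
    + hcw_A (inord k) (inord 3) * x (inord 3) 0)).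
  have iE (i : 'I_(2 + 2)) (j : nat) : val i = j -> i = inord j.
    by move=> <-; rewrite inord_val.
  rewrite mxE 4!big_ord_recl big_ord0 addr0.
  rewrite (iE (lift _ (lift _ (lift _ _))) 3%N) //.
  by rewrite (iE (lift _ (lift _ _)) 2%N) // (iE (lift _ _) 1%N) //
    (iE ord0 0%N).
have u0 : (inord 0 : 'I_2) = 0 by apply/val_inj; rewrite /= inordK.
have u1 : (inord 1 : 'I_2) = 1 by apply/val_inj; rewrite /= inordK.
have DE (k : nat) : (hcw_A *m x + hcw_B *m u) (inord k) 0
    = (hcw_A *m x) (inord k) 0 + (hcw_B *m u) (inord k) 0 by rewrite mxE.
rewrite /= !DE !BE // !AE !mxE !inordK //= subnn u0.
rewrite -[(3 - 2)%N]/1%N u1.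
by split; ring.
Qed.

Definition hcw_aug : 'M[R]_(2 + 2 + 2) :=
  dt *: block_mx hcw_A hcw_B (0 : 'M[R]_(2, 2 + 2)) (0 : 'M[R]_2).

Definition hcw_Ad : 'M[R]_(2 + 2) := ulsubmx (expmx hcw_aug).

Definition hcw_Bd : 'M[R]_(2 + 2, 2) := ursubmx (expmx hcw_aug).

Lemma expmx_hcw_aug : expmx hcw_aug = block_mx hcw_Ad hcw_Bd 0 1%:M.
Proof.
rewrite -[LHS]submxK -/hcw_Ad -/hcw_Bd.
have cv := @is_cvg_series_expmx_coeff _ _ hcw_aug.
have dE k : dsubmx (hcw_aug ^+ k.+1) = 0.
  rewrite exprS /hcw_aug scale_block_mx !scaler0 /block_mx.
  by rewrite [X in dsubmx X]mul_col_mx col_mxKd row_mx0 mul0mx.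
have sE k : dsubmx (series (expmx_coeff hcw_aug) k.+1) = row_mx 0 1%:M.
  rewrite /series /= big_nat_recl//= linearD /= linear_sum /= big1 => [|i _].
    rewrite addr0 /expmx_coeff fact0 invr1 scale1r expr0.
    by rewrite [1](scalar_mx_block _ _ 1) col_mxKd.
  by rewrite /expmx_coeff linearZ /= dE scaler0.
have lE i j : expmx hcw_aug (rshift _ i) j
    = (row_mx 0 1%:M : 'M[R]_(2, 2 + 2 + 2)) i j.
  have /cvg_lim <- // :
      series (expmx_coeff hcw_aug) k (rshift (2 + 2) i) j @[k --> \oo]
      --> expmx hcw_aug (rshift (2 + 2) i) j.
    have h := @coord_continuous R _ _ (rshift (2 + 2) i) j (expmx hcw_aug).
    exact: (cvg_comp _ _ cv h).
  apply: cvg_lim => //; rewrite -(cvg_shiftS _).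
  rewrite [X in X @ _](_ : _ =
      fun=> (row_mx 0 1%:M : 'M[R]_(2, 2 + 2 + 2)) i j).
    exact: cvg_cst.
  by apply/funext => k; rewrite -(sE k) mxE.
have dsE : dsubmx (expmx hcw_aug) = row_mx 0 1%:M.
  by apply/matrixP => i j; rewrite mxE lE.
by rewrite /dlsubmx /drsubmx dsE row_mxKl row_mxKr.
Qed.

Fixpoint state (N : nat) (x0 : 'cV[R]_(2 + 2)) (U : 'I_N -> 'cV[R]_2)
    (k : nat) : 'cV[R]_(2 + 2) :=
  if k is k'.+1 then
    (* [insub k'] is [Some] of the ordinal [k'] as long as [k' < N]. *)
    hcw_Ad *m state x0 U k' + hcw_Bd *m oapp U 0 (insub k')
  else x0.

Definition final_position (N : nat) (x0 : 'cV[R]_(2 + 2))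
    (U : 'I_N -> 'cV[R]_2) : 'cV[R]_2 :=
  usubmx (state x0 U N).

Definition admissible (N : nat) (ubar : R) : set ('I_N -> 'cV[R]_2) :=
  [set U | forall k, `|U k| <= ubar].

Definition reachable (N : nat) (ubar : R) (x0 : 'cV[R]_(2 + 2)) :
    set 'cV[R]_2 :=
  [set final_position x0 U | U in @admissible N ubar].

End Dynamics.

Section OuterPolytope.
Variable R : realType.

(* [L] equally spaced unit vectors; [theta] is the angle of the first one. *)
Definition template_dir (theta : R) (L : nat) (l : 'I_L) : 'cV[R]_2 :=
  let a := theta + 2 * pi * l%:R / L%:R in
  \col_i (if i == 0 then cos a else sin a).

Definition outer_polytope (theta : R) (L : nat) (S : set 'cV[R]_2) :
    set 'cV[R]_2 :=
  \bigcap_(l in [set: 'I_L])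
    [set r | dot (template_dir theta l) r <= support S (template_dir theta l)].

End OuterPolytope.

Section Security.
Variables (R : realType) (n dt : R) (N L : nat) (theta : R).
Variables (uP uE : R) (xP xE : 'cV[R]_(2 + 2)).

Definition evader_polytope : set 'cV[R]_2 :=
  outer_polytope theta L (reachable n dt N uE xE).

Definition worst_dist (U : 'I_N -> 'cV[R]_2) : R :=
  max_dist (vertices evader_polytope) (final_position n dt xP U).

(* The infimum is a minimum, attained exactly by the controls satisfying
   [security_control] below. *)
Definition security_value : R := inf [set worst_dist U | U in admissible uP].

Definition security_control (U : 'I_N -> 'cV[R]_2) : Prop :=
  admissible uP U /\ worst_dist U = security_value.

End Security.

(* Main.v *)
(** The evader polytope is a polyhedron whose equally spaced normals positively
    span the plane.  A point of it is a vertex iff no nonzero direction is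
    orthogonal to all its active normals; so vertices are determined by their
    active sets (finitely many), and any other point can be pushed along such a
    direction, without getting closer to a given centre [c], until a further
    constraint becomes active.  Hence the distance to [c] over the polytope is
    maximal at a vertex, which gives the capture bound since the polytope
    contains the reachable set.  Security controls exist because the worst-case
    distance is continuous on the compact set of admissible controls. *)

Require Import Defs.
From HB Require Import structures.
From mathcomp Require Import all_boot all_order all_algebra.
From mathcomp Require Import finmap.
From mathcomp Require Import all_classical all_reals all_analysis.
From mathcomp Require Import ring lra.

Set Implicit Arguments.
Unset Strict Implicit.
Unset Printing Implicit Defensive.

Import Order.TTheory GRing.Theory Num.Theory.
Import numFieldNormedType.Exports.
Import ArrowAsProduct.

Local Open Scope classical_set_scope.
Local Open Scope ring_scope.

(** * Inner product and Euclidean norm *)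

Section Dot.
Variables (R : realType) (m : nat).
Implicit Types d u v : 'cV[R]_m.

Lemma dotDr d u v : dot d (u + v) = dot d u + dot d v.
Proof. by rewrite -big_split; apply: eq_bigr => i _; rewrite mxE mulrDr. Qed.

Lemma dotZr d (t : R) u : dot d (t *: u) = t * dot d u.
Proof. by rewrite mulr_sumr; apply: eq_bigr => i _; rewrite mxE mulrCA. Qed.

Lemma dotNr d u : dot d (- u) = - dot d u.
Proof. by rewrite -scaleN1r dotZr mulN1r. Qed.

Lemma dotC u v : dot u v = dot v u.
Proof. by apply: eq_bigr => i _; rewrite mulrC. Qed.

Lemma dot_ge0 u : 0 <= dot u u.
Proof. by apply: sumr_ge0 => i _; rewrite -expr2 sqr_ge0. Qed.

Lemma norm2E u : norm2 u = Num.sqrt (dot u u).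
Proof. by congr Num.sqrt; apply: eq_bigr => i _; rewrite expr2. Qed.

(** Expanding the square adds [2 * s * dot u v] and [s ^+ 2 * dot v v], both nonnegative. *)
Lemma norm2_le_ray u v (s : R) :
  0 <= s -> 0 <= dot u v -> norm2 u <= norm2 (u + s *: v).
Proof.
move=> s0 uv0; rewrite !norm2E ler_wsqrtr//.
rewrite dotDr dotZr ![dot (_ + _) _]dotC !dotDr !dotZr (dotC v u).
have := mulr_ge0 s0 uv0; have := mulr_ge0 (mulr_ge0 s0 s0) (dot_ge0 v).
by rewrite mulrDr !mulrA; lra.
Qed.

End Dot.

(** * Vertices of a polyhedron and farthest points *)

Section Polyhedron.
Variables (R : realType) (m : nat) (I : finType).
Variables (d : I -> 'cV[R]_m) (b : I -> R).

Definition polyhedron : set 'cV[R]_m := [set r | forall i, dot (d i) r <= b i].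

Definition active (r : 'cV[R]_m) : {set I} := [set i | dot (d i) r == b i]%SET.

Lemma activeP r i : reflect (dot (d i) r = b i) (i \in active r).
Proof. by rewrite inE; exact: eqP. Qed.

(** Active constraints are constant along [u], and the finitely many inactive ones have positive
    slack. *)
Lemma small_step r u : polyhedron r ->
  (forall i, i \in active r -> dot (d i) u = 0) ->
  exists2 e : R, 0 < e & polyhedron (r + e *: u).
Proof.
move=> Pr u0.
(* Slack over a bound on the growth along [u]; the [1] keeps the denominator positive. The default
   [1] of the minimum below covers the case where every constraint is active. *)
pose q i := (b i - dot (d i) r) / (1 + `|dot (d i) u|).
have den i : 0 < 1 + `|dot (d i) u| by rewrite ltr_pwDl ?ltr01 ?normr_ge0.
exists (\big[Num.min/1]_(i | i \notin active r) q i).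
  apply/bigmin_gtP; split=> [|i ia]; first exact: ltr01.
  rewrite divr_gt0//.
  by rewrite subr_gt0 lt_neqAle Pr andbT; apply: contra ia => /eqP/activeP.
move=> i; rewrite dotDr dotZr; have [ia|ia] := boolP (i \in active r).
  by rewrite u0// mulr0 addr0.
rewrite -lerBrDl; set e := bigop _ _ _.
have e0 : 0 <= e.
  by apply/bigmin_geP; split=> // j _; rewrite divr_ge0 ?subr_ge0 ?Pr ?ltW.
have : e <= q i by exact: bigmin_le_cond.
rewrite ler_pdivlMr//.
apply: le_trans; rewrite ler_wpM2l//.
by rewrite (le_trans (ler_norm _))// lerDr ler01.
Qed.

(** Small steps along a nonzero [u] and along [- u] would put [v] inside a segment. Conversely, a
    constraint active inside a segment is active at both ends, so [x - y] is orthogonal to the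
    active normals. *)
Lemma vertices_polyhedronP v : vertices polyhedron v <->
  polyhedron v /\
  forall u, (forall i, i \in active v -> dot (d i) u = 0) -> u = 0.
Proof.
split=> -[Pv H]; split=> //.
- move=> u u0.
  have [e e0 Pe] := small_step Pv u0.
  have Nu0 i : i \in active v -> dot (d i) (- u) = 0.
    by move=> /u0; rewrite dotNr => ->; rewrite oppr0.
  have [f f0 Pf] := small_step Pv Nu0.
  have ef0 : e + f != 0 by rewrite gt_eqF// addr_gt0.
  (* With this weight the displacements [e *: u] and [f *: - u] cancel. *)
  have t01 : 0 < f / (e + f) < 1.
    by rewrite divr_gt0 ?addr_gt0// ltr_pdivrMr ?addr_gt0// mul1r ltrDr.
  have [|/eqP + _] := H _ _ _ Pe Pf t01.
    rewrite !scalerDr addrACA -scalerDl [_ + (1 - _)]addrC subrK scale1r.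
    rewrite !scalerA scalerN -scalerBl.
    rewrite (_ : _ - _ = 0) ?scale0r ?addr0//; field.
    exact: ef0.
  by rewrite -subr_eq0 addrC addKr scaler_eq0 gt_eqF//= => /eqP.
- move=> x y t Px Py /andP[t0 t1] vE.
  suff /subr0_eq xy : x - y = 0.
    by rewrite vE xy -scalerDl addrC subrK scale1r.
  apply: H => i /activeP iv; rewrite dotDr dotNr.
  move: iv; rewrite vE dotDr !dotZr; have := Px i; have := Py i; nra.
Qed.

(** Two vertices with the same active set differ by a vector orthogonal to all its normals, hence
    coincide. *)
Lemma finite_vertices_polyhedron : finite_set (vertices polyhedron).
Proof.
(* The default [0], for sets active at no vertex, is harmless: the vertices need only lie in the
   image of [g]. *)
pose g (A : {set I}) := xget 0 [set v | vertices polyhedron v /\ active v = A].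
apply: (@sub_finite_set _ _ (g @` setT)); last exact/finite_image/finite_finset.
move=> v Vv; exists (active v) => //.
rewrite /g; case: xgetP => [w _ [Vw vw]|/(_ v)[]//].
have /vertices_polyhedronP[Pv /(_ (w - v))] := Vv.
move=> H; apply/subr0_eq/H => i iv.
rewrite dotDr dotNr; move: (iv) => /activeP ->.
by move: iv; rewrite -vw => /activeP ->; rewrite subrr.
Qed.

Hypothesis d_spanning : forall u, u != 0 -> exists i, 0 < dot (d i) u.

(** Induction on the number of inactive constraints. By [d_spanning] some constraint grows along any
    nonzero direction, so each push is stopped. *)
Lemma polyhedron_farther_vertex c p : polyhedron p ->
  exists2 v, vertices polyhedron v & norm2 (c - p) <= norm2 (c - v).
Proof.
have [k] := ubnP #|~: active p|; elim: k p => // k IH p /ltnSE kp Pp.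
have [/(conj Pp)/vertices_polyhedronP Vp|/existsNP[u0 /not_implyP[u00 /eqP u0N]]] :=
    pselect (forall u, (forall i, i \in active p -> dot (d i) u = 0) -> u = 0).
  by exists p.
(* Both [u0] and [- u0] are orthogonal to the active normals; one not pointing towards [c] is
   kept. *)
have [u [uN u0' cu]] : exists u, [/\ u != 0,
    forall i, i \in active p -> dot (d i) u = 0 & dot (c - p) u <= 0].
  have [cu|cu] := leP (dot (c - p) u0) 0; first by exists u0.
  exists (- u0); rewrite oppr_eq0 dotNr oppr_le0 ltW//; split=> // i /u00 ui.
  by rewrite dotNr ui oppr0.
have [i0 i0u] := d_spanning uN.
(* The step at which constraint [i] becomes tight; the least one, among constraints growing along
   [u], is the longest step inside the polyhedron. *)
pose s i := (b i - dot (d i) p) / dot (d i) u.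
case: (@Order.TotalTheory.arg_minP _ _ _ i0 (fun i => 0 < dot (d i) u) s i0u).
move=> j ju jmin.
have sj : 0 <= s j by rewrite divr_ge0 ?subr_ge0 ?Pp ?ltW.
have Pq : polyhedron (p + s j *: u).
  move=> i; rewrite dotDr dotZr; have [iu|iu] := ltP 0 (dot (d i) u).
    by rewrite -lerBrDl -ler_pdivlMr// jmin.
  by rewrite -[leRHS]addr0 lerD// mulr_ge0_le0.
have jp : j \notin active p.
  by apply: contraL ju => /u0' ->; rewrite ltxx.
have jq : j \in active (p + s j *: u).
  by apply/activeP; rewrite dotDr dotZr divfK ?gt_eqF// addrC subrK.
have apq : active p \subset active (p + s j *: u).
  apply/fintype.subsetP => i ip; apply/activeP.
  rewrite dotDr dotZr u0'// mulr0 addr0.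
  exact/activeP.
have [|v Vv qv] := IH (p + s j *: u) _ Pq.
  apply: leq_trans kp; apply: proper_card; apply/fintype.properP; split.
    by rewrite finset.setCS.
  by exists j; rewrite inE ?jp ?jq.
exists v => //; apply: le_trans qv.
rewrite opprD addrA -scalerN norm2_le_ray//.
by rewrite dotNr oppr_ge0.
Qed.

Lemma vertices_polyhedron_neq0 :
  polyhedron !=set0 -> vertices polyhedron !=set0.
Proof. by move=> [p /(polyhedron_farther_vertex 0)[v Vv _]]; exists v. Qed.

End Polyhedron.

(** * Positive spanning by equally spaced directions *)

Section TemplateDirections.
Variables (R : realType) (theta : R) (L : nat).
Hypothesis L_ge3 : (3 <= L)%N.

(* The equally spaced directions sum to zero, and two consecutive ones are
   linearly independent. *)
Lemma template_dir_spanning (u : 'cV[R]_2) :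
  u != 0 -> exists l : 'I_L, 0 < dot (template_dir theta l) u.
Proof.
move=> u0; apply: contrapT => /forallNP dle.
pose h : R := 2 * pi / L%:R.
have L0 : 0 < L%:R :> R by rewrite ltr0n (leq_trans _ L_ge3).
pose a (k : nat) := theta + h * k%:R.
have dE (l : 'I_L) :
    dot (template_dir theta l) u = cos (a l) * u 0 0 + sin (a l) * u 1 0.
  rewrite /dot !big_ord_recl big_ord0 addr0 !mxE/=.
  rewrite (_ : lift ord0 ord0 = 1); last exact/val_inj.
  by rewrite /a /h [2 * pi / L%:R * _]mulrAC.
pose c k := cos (a k) * u 0 0 + sin (a k) * u 1 0.
(* Shifting by half a step makes each increment of [g] a constant multiple of [c k], so the sum of
   the [c k] telescopes over a full turn. *)
pose g k := sin (a k - h / 2) * u 0 0 - cos (a k - h / 2) * u 1 0.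
have gS k : g k.+1 - g k = 2 * sin (h / 2) * c k.
  rewrite /g /c (_ : a k.+1 - h / 2 = a k + h / 2); last first.
    by rewrite /a -natr1 mulrDr mulr1; field.
  by rewrite sinD cosD sinB cosB; ring.
have pi0 := pi_gt0 R.
have h0 : 0 < h by rewrite divr_gt0// mulr_gt0.
(* At least three directions make the angle less than [pi], so consecutive ones are independent. *)
have hpi : h < pi.
  by rewrite ltr_pdivrMr// mulrC ltr_pM2l// (ltr_nat _ 2).
have sh0 : 0 < sin h by apply: sin_gt0_pi; rewrite h0.
have sh20 : 0 < sin (h / 2) by apply: sin_gt0_pi; lra.
have sumc : \sum_(l < L) c l = 0.
  have : 2 * sin (h / 2) * \sum_(l < L) c l = 0.
    rewrite mulr_sumr; under eq_bigr do rewrite -gS.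
    rewrite -(big_mkord xpredT (fun k => g k.+1 - g k)) telescope_sumr// /g.
    rewrite (_ : a L - h / 2 = (a 0%N - h / 2) + pi *+ 2); last first.
      by rewrite /a /h -mulr_natr; field; rewrite gt_eqF.
    by rewrite sinD2pi cosD2pi subrr.
  by move=> /eqP; rewrite mulf_eq0 gt_eqF ?mulr_gt0//= => /eqP.
have c_le0 (l : 'I_L) : c l <= 0 by have /negP := dle l; rewrite dE -leNgt.
(* Nonpositive terms with zero sum all vanish. *)
have c0 k : (k < L)%N -> c k = 0.
  move=> kL; apply/eqP; rewrite -oppr_eq0.
  have /eqP := sumc; rewrite -oppr_eq0 -sumrN psumr_eq0 => [|l _]; last first.
    by rewrite oppr_ge0.
  by move=> /allP/(_ (Ordinal kL)); rewrite mem_index_enum => /(_ isT).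
have := c0 0%N (ltnW (ltnW L_ge3)); have := c0 1%N (ltnW L_ge3).
have a1 : a 1%N = a 0%N + h by rewrite /a mulr0 mulr1 addr0.
rewrite /c a1 (sinD (a 0%N)) (cosD (a 0%N)).
set x := cos (a 0%N); set y := sin (a 0%N) => c1 c00.
have xy : x ^+ 2 + y ^+ 2 = 1 by exact: cos2Dsin2.
(* Subtracting [cos h] times the first equation from the second leaves [sin h] times the component
   of [u] along the first direction turned by a right angle. *)
have v0 : (- y * u 0 0 + x * u 1 0) * sin h = 0.
  rewrite -[LHS]add0r -[X in X + _](mulr0 (cos h)) -{1}c00.
  by apply: etrans c1; ring.
have {}v0 : - y * u 0 0 + x * u 1 0 = 0.
  by move/eqP: v0; rewrite mulf_eq0 (gt_eqF sh0) orbF => /eqP.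
have U0 : u 0 0 = 0.
  rewrite -[LHS]mul1r -xy.
  transitivity (x * (x * u 0 0 + y * u 1 0) - y * (- y * u 0 0 + x * u 1 0)).
    by ring.
  by rewrite c00 v0 !mulr0 subrr.
have U1 : u 1 0 = 0.
  rewrite -[LHS]mul1r -xy.
  transitivity (y * (x * u 0 0 + y * u 1 0) + x * (- y * u 0 0 + x * u 1 0)).
    by ring.
  by rewrite c00 v0 !mulr0 addr0.
move/eqP: u0; apply; apply/matrixP => i j; rewrite ord1 mxE.
by case: i => -[|[|//]] ?; [rewrite -[RHS]U0|rewrite -[RHS]U1];
  congr (u _ _); exact/val_inj.
Qed.

End TemplateDirections.

(** * Coordinatewise continuity *)

Section CoordContinuity.
Variables (R : realType) (T : topologicalType) (q : nat) (f : T -> 'cV[R]_q).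
Hypothesis coord_cf : forall j, continuous (fun x => f x j 0).

Lemma coord_mulmx_continuous (p : nat) (A : 'M[R]_(p, q)) i :
  continuous (fun x => (A *m f x) i 0).
Proof.
under [X in continuous X]eq_fun do rewrite mxE.
apply: continuous_big => [|j _]; first exact: add_continuous.
by move=> x; apply: cvgM; [exact: cvg_cst|exact: coord_cf].
Qed.

Lemma dot_continuous (d : 'cV[R]_q) : continuous (fun x => dot d (f x)).
Proof.
apply: continuous_big => [|j _]; first exact: add_continuous.
by move=> x; apply: cvgM; [exact: cvg_cst|exact: coord_cf].
Qed.

Lemma norm2_continuous (v : 'cV[R]_q) : continuous (fun x => norm2 (f x - v)).
Proof.
move=> x; apply: (@continuous_comp _ _ _
  (fun x => \sum_i (f x - v) i 0 ^+ 2)); last exact: sqrt_continuous.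
move: x; apply: continuous_big => [|j _]; first exact: add_continuous.
move=> x; apply: (@continuous_comp _ _ _ (fun x => (f x - v) j 0)
  (fun y : R => y ^+ 2)); last exact: exprn_continuous.
under [X in {for _, continuous X}]eq_fun do rewrite mxE.
by apply: cvgD; [exact: coord_cf|exact: cvg_cst].
Qed.

End CoordContinuity.

Lemma continuous_addf (R : realType) (T : topologicalType) (f g : T -> R) :
  continuous f -> continuous g -> continuous (fun x => f x + g x).
Proof. by move=> cf cg x; apply: cvgD; [exact: cf|exact: cg]. Qed.

(** * Compactness of the admissible controls *)

Section Compactness.
Variables (R : realType) (N : nat).

Lemma trmx_continuous (p q : nat) : continuous (@trmx R p q).
Proof.
move=> /= M s /= /nbhs_ballP[e e0 es].
apply/nbhs_ballP; exists e => //= A [_ MA]; apply: es; split=> // i j.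
by rewrite !mxE; exact: MA.
Qed.

Lemma normcV_le (p : nat) (v : 'cV[R]_p) (c : R) :
  0 <= c -> (`|v| <= c) = [forall i, `|v i 0| <= c].
Proof.
move=> c0; rewrite [leLHS]mx_normrE; apply/idP/idP.
  by move=> /bigmax_leP[_ H]; apply/forallP => i; exact: (H (i, 0)).
by move=> /forallP H; apply/bigmax_leP; split=> // -[i j] _; rewrite ord1.
Qed.

(** The ball of the sup norm is the transpose of a product of segments. *)
Lemma compact_cV_ball (p : nat) (c : R) : 0 <= c ->
  compact [set v : 'cV[R]_p | `|v| <= c].
Proof.
move=> c0.
pose A : set 'rV[R]_p := [set v | forall i, v 0 i \in `[- c, c]].
have cA : compact A.
  apply: (@rV_compact R p (fun=> [set` `[- c, c]])) => i.
  exact: segment_compact.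
rewrite (_ : [set _ | _] = trmx @` A).
  apply: continuous_compact cA; apply: continuous_subspaceT.
  exact: trmx_continuous.
apply/seteqP; split=> [v /= vc|_ [v vA <-]] /=.
  exists v^T; last exact: trmxK.
  move=> i; rewrite mxE in_itv/= -ler_norml.
  by move: vc; rewrite normcV_le// => /forallP.
rewrite normcV_le//; apply/forallP => i; rewrite mxE ler_norml.
exact: vA.
Qed.

(** Control sequences carry the product topology, so Tychonoff's theorem applies. *)
Lemma compact_admissible (c : R) : 0 <= c -> compact (@admissible R N c).
Proof.
move=> c0; apply: (@tychonoff _ (fun=> 'cV[R]_2) (fun=> [set v | `|v| <= c])).
by move=> k; exact: compact_cV_ball.
Qed.

Lemma admissible_neq0 (c : R) : 0 <= c -> @admissible R N c !=set0.
Proof. by move=> c0; exists (fun=> 0) => k; rewrite normr0. Qed.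

Variables (n dt : R) (x0 : 'cV[R]_(2 + 2)).

Lemma coord_final_position_continuous i :
  continuous (fun U : 'I_N -> 'cV[R]_2 => final_position n dt x0 U i 0).
Proof.
suff cs k j : continuous (fun U : 'I_N -> 'cV[R]_2 => state n dt x0 U k j 0).
  rewrite (_ : (fun=> _) = fun U => state n dt x0 U N (lshift 2 i) 0).
    exact: cs.
  by apply/funext => U; rewrite mxE.
elim: k j => [|k IH] j; first exact: cst_continuous.
rewrite (_ : (fun=> _) = fun U => (hcw_Ad n dt *m state n dt x0 U k) j 0 +
    (hcw_Bd n dt *m oapp U 0 (insub k)) j 0); last first.
  by apply/funext => U; rewrite [LHS]mxE.
apply: continuous_addf; apply: coord_mulmx_continuous; first exact: IH.
move=> j'.
(* From index [N] on, [insub] gives [None] and the control read is the constant [0]. *)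
case: (insub k) => [l|]; last exact: cst_continuous.
move=> W.
apply: (@continuous_comp _ _ _ (fun U : 'I_N -> 'cV[R]_2 => U l)
  (fun v : 'cV[R]_2 => v j' 0)); last exact: coord_continuous.
exact: (@proj_continuous _ (fun=> 'cV[R]_2) l).
Qed.

(** [support] is a [sup], which dominates only sets bounded above; a maximiser over the compact set
    of controls gives that bound. *)
Lemma reachable_sub_polytope (L : nat) (theta c : R) : 0 <= c ->
  reachable n dt N c x0 `<=` evader_polytope n dt N L theta c x0.
Proof.
move=> c0 r rr l _ /=; set d := template_dir theta l.
have cE : {within admissible c, continuous
    (fun U : 'I_N -> 'cV[R]_2 => dot d (final_position n dt x0 U))}.
  apply: continuous_subspaceT; apply: dot_continuous.
  exact: coord_final_position_continuous.
have [W _ Wmax] :=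
  compact_EVT_max (admissible_neq0 c0) (compact_admissible c0) cE.
apply: ub_le_sup; last by exists r.
exists (dot d (final_position n dt x0 W)) => _ [_ [U aU <-] <-].
by apply: Wmax; rewrite inE.
Qed.

End Compactness.

(** * Maximal distance to a finite set *)

Section MaxDist.
Variables (R : realType) (m : nat) (V : set 'cV[R]_m).
Hypotheses (finV : finite_set V) (V0 : V !=set0).

Lemma norm2_le_max_dist (r v : 'cV[R]_m) : V v -> norm2 (r - v) <= max_dist V r.
Proof.
move=> Vv; apply: ub_le_sup; last by exists v.
exists (\big[Num.max/0]_(w <- fset_set V) norm2 (r - w)) => _ [w Vw <-].
apply: (le_bigmax_seq 0 w xpredT (fun w => norm2 (r - w))) => //.
by rewrite in_fset_set// inE.
Qed.

(** As a finite maximum, the distance inherits continuity from each term. The default [0] is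
    harmless: distances are nonnegative and [V] is nonempty. *)
Lemma max_distE (r : 'cV[R]_m) :
  max_dist V r = \big[Num.max/0]_(v <- fset_set V) norm2 (r - v).
Proof.
apply/eqP; rewrite eq_le; apply/andP; split.
  apply: ge_sup; first by case: V0 => v Vv; exists (norm2 (r - v)), v.
  move=> _ [w Vw <-].
  apply: (le_bigmax_seq 0 w xpredT (fun w => norm2 (r - w))) => //.
  by rewrite in_fset_set// inE.
rewrite big_seq; apply: bigmax_le => [|v]; last first.
  by rewrite in_fset_set// inE; exact: norm2_le_max_dist.
by have [v Vv] := V0; apply: le_trans (norm2_le_max_dist r Vv); exact: sqrtr_ge0.
Qed.

Lemma max_dist_continuous (T : topologicalType) (f : T -> 'cV[R]_m) :
  (forall j, continuous (fun x => f x j 0)) ->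
  continuous (fun x => max_dist V (f x)).
Proof.
move=> cf; under [X in continuous X]eq_fun do rewrite max_distE.
by apply: continuous_big => [|v _]; [exact: max_continuous|exact: norm2_continuous].
Qed.

End MaxDist.

(** * Security controls and the capture guarantee *)

Lemma evader_polytopeE (R : realType) (n dt : R) (N L : nat) (theta c : R)
    (x0 : 'cV[R]_(2 + 2)) :
  evader_polytope n dt N L theta c x0 =
  polyhedron (@template_dir R theta L)
    (fun l => Defs.support (reachable n dt N c x0) (template_dir theta l)).
Proof. by apply/seteqP; split=> r Pr l *; exact: Pr. Qed.

Lemma security_control_exists (R : realType) (n dt : R) (N L : nat)
    (theta uP uE : R) (xP xE : 'cV[R]_(2 + 2)) :
  let V := vertices (evader_polytope n dt N L theta uE xE) in
  0 <= uP -> finite_set V -> V !=set0 ->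
  exists U : 'I_N -> 'cV[R]_2, security_control n dt L theta uP uE xP xE U.
Proof.
move=> V uP0 finV V0; pose f := @worst_dist R n dt N L theta uE xP xE.
have cf : {within admissible uP, continuous f}.
  apply: continuous_subspaceT; apply: max_dist_continuous => //.
  exact: coord_final_position_continuous.
have [U] :=
  compact_EVT_min (admissible_neq0 N uP0) (compact_admissible uP0) cf.
rewrite inE => aU Umin; exists U; split=> //.
have lbU : lbound [set f W | W in admissible uP] (f U).
  by move=> _ [W aW <-]; apply: Umin; rewrite inE.
(* A lower bound that is attained is the infimum. *)
apply/eqP; rewrite eq_le; apply/andP; split.
  by apply: lb_le_inf lbU; exists (f U), U.
by apply: ge_inf; [exists (f U)|exists U].
Qed.

Theorem mainTheorem3 (R : realType) (n dt : R) (N L : nat) (theta : R)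
    (uP uE : R) (xP xE : 'cV[R]_(2 + 2))
    (n_gt0 : 0 < n) (dt_gt0 : 0 < dt) (N_ge1 : (1 <= N)%N) (L_ge3 : (3 <= L)%N)
    (uE_gt0 : 0 < uE) (uE_lt_uP : uE < uP) :
  let V := vertices (evader_polytope n dt N L theta uE xE) in
  let Vbar := security_value n dt N L theta uP uE xP xE in
  let security := @security_control R n dt N L theta uP uE xP xE in
  [/\ finite_set V,
      V !=set0,
      (exists U, security U) &
      forall UP : 'I_N -> 'cV[R]_2, security UP ->
        (forall UE : 'I_N -> 'cV[R]_2, admissible uE UE ->
           norm2 (final_position n dt xP UP - final_position n dt xE UE)
             <= Vbar) /\
        (forall rcap : R, 0 < rcap -> Vbar <= rcap ->
           forall UE : 'I_N -> 'cV[R]_2, admissible uE UE ->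
             norm2 (final_position n dt xP UP - final_position n dt xE UE)
               <= rcap)].
Proof.
move=> V Vbar security.
have spanning := template_dir_spanning theta L_ge3.
have finV : finite_set V.
  by rewrite /V evader_polytopeE; exact: finite_vertices_polyhedron.
have reachP (UE : 'I_N -> 'cV[R]_2) : admissible uE UE ->
    evader_polytope n dt N L theta uE xE (final_position n dt xE UE).
  by move=> aU; apply: reachable_sub_polytope; [exact: ltW|exists UE].
have V0 : V !=set0.
  have [U aU] := admissible_neq0 N (ltW uE_gt0).
  rewrite /V evader_polytopeE; apply: vertices_polyhedron_neq0 => //.
  by rewrite -evader_polytopeE; exists (final_position n dt xE U); exact: reachP.
(* With the pursuer's terminal position as centre, the evader's one, lying in the polytope, is no
   farther than some vertex. *)
have bound UP : security UP ->
    forall UE : 'I_N -> 'cV[R]_2, admissible uE UE ->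
    norm2 (final_position n dt xP UP - final_position n dt xE UE) <= Vbar.
  move=> [_ VE] UE aUE; have := reachP _ aUE; rewrite /Vbar -VE evader_polytopeE.
  move=> /(polyhedron_farther_vertex spanning (final_position n dt xP UP)).
  rewrite -evader_polytopeE => -[v Vv] /le_trans; apply.
  exact: norm2_le_max_dist.
split=> //.
  by apply: security_control_exists => //; exact/ltW/(lt_trans uE_gt0).
move=> UP secUP; split; first exact: bound.
by move=> rcap _ Vrcap UE aUE; apply: le_trans Vrcap; exact: bound.
Qed.
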